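(* Let $F:[0,1]\to\mathfrak J$ be continuous with respect to the metric $d_\mu$. Then for any $\varepsilon>0$ there exists $N>0$ such that for all $n\ge N$ and all $x\in[0,1]$, $$d_\mu\big(F(x),B_n(F,x)\big)<\varepsilon,$$ where $B_n(F,x)=\bigotimes_{i=0}^n\binom ni x^i(1-x)^{n-i}F\big(\tfrac in\big)$ is the set-valued Bernstein operator (a partition average).
   Context: Fix $m\ge1$ and let $\mu$ be Lebesgue measure on $\mathbb R^m$. $\mathbb J$ denotes the collection of Jordan measurable subsets of $\mathbb R^m$ (bounded sets whose boundary has Lebesgue measure zero). $\operatorname{ci}(A)$ is the closure of the interior of $A$; a bounded set $A$ is regular compact if $A=\operatorname{ci}(A)$. $\mathfrak J\subset\mathbb J$ is the collection of regular compact sets in $\mathbb J$ (including $\emptyset$), with the metric $d_\mu(A,B)=\mu(A\Delta B)$, $\Delta$ being symmetric difference. A subset-generating function is a map $\Psi:\mathbb J\times[0,1]\to\mathfrak J$ such that for all $A\in\mathbb J$ and $s,t\in[0,1]$: (1) $\Psi(A,t)\subseteq A$ up to a null set, i.e. $\mu(\Psi(A,t)\setminus A)=0$; (2) $\mu(\Psi(A,t))=t\,\mu(A)$; (3) $\Psi(A,s)\subseteq\Psi(A,t)$ if $s\le t$. A subset-generating function $\Psi$ is fixed. For $A_0,\dots,A_n\in\mathfrak J$ and nonempty $\chi\subseteq\{0,\dots,n\}$ put $\Omega_\chi=\big(\bigcap_{k\in\chi}A_k\big)\setminus\big(\bigcup_{l\in\{0,\dots,n\}\setminus\chi}A_l\big)$,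 and $\Omega_\emptyset=\emptyset$. For weights $\alpha_i\in[0,1]$ with $\sum_i\alpha_i=1$, the partition average is $\bigotimes_{i=0}^n\alpha_iA_i:=\bigcup_{\chi\subseteq\{0,\dots,n\}}\Psi\big(\Omega_\chi,\sum_{k\in\chi}\alpha_k\big)\in\mathfrak J$. *)

(* Defs.v *)
From HB Require Import structures.
From mathcomp Require Import all_boot all_order all_algebra.
From mathcomp Require Import all_classical all_reals all_analysis.

Set Implicit Arguments.
Unset Strict Implicit.
Unset Printing Implicit Defensive.

Import Order.TTheory GRing.Theory Num.Theory.
Import numFieldNormedType.Exports.

Local Open Scope classical_set_scope.
Local Open Scope ring_scope.

(* R^n for n >= 1 is 'rV[R]_m.+1 with n = m.+1. Its library norm is the sup
   norm, which gives the usual topology and the usual bounded sets. *)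

Section lebesgue_measure_rV.
Context (R : realType) (m : nat).
Local Open Scope ereal_scope.

(* A box is the product of the half-open intervals ]a_i, b_i], coded by the
   pair (a, b); it is empty, with volume 0, as soon as some b_i <= a_i. *)
Definition box (B : 'rV[R]_m.+1 * 'rV[R]_m.+1) : set 'rV[R]_m.+1 :=
  [set x | forall i, (B.1 ord0 i < x ord0 i <= B.2 ord0 i)%R].

Definition box_volume (B : 'rV[R]_m.+1 * 'rV[R]_m.+1) : \bar R :=
  (\prod_(i < m.+1) Num.max 0 (B.2 ord0 i - B.1 ord0 i))%:E.

Definition lebesgue_outer (A : set 'rV[R]_m.+1) : \bar R :=
  ereal_inf [set \sum_(k <oo) box_volume (B k) | B in
    [set B : nat -> 'rV[R]_m.+1 * 'rV[R]_m.+1 |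
      A `<=` \bigcup_k box (B k)]].

Lemma box_volume_ge0 B : 0 <= box_volume B.
Proof.
by rewrite lee_fin; apply: prodr_ge0 => i _; rewrite le_max lexx.
Qed.

Lemma lebesgue_outer_ge0 A : 0 <= lebesgue_outer A.
Proof.
apply: le_ereal_inf_tmp => _ [B _ <-].
by apply: nneseries_ge0 => n _ _; exact: box_volume_ge0.
Qed.

Lemma le_lebesgue_outer : {homo lebesgue_outer : A B / A `<=` B >-> A <= B}.
Proof.
move=> A B AB; apply: ereal_inf_le_tmp => x [C BC <-].
by exists C => //; exact: subset_trans BC.
Qed.

Lemma lebesgue_outer0 : lebesgue_outer set0 = 0.
Proof.
apply/eqP; rewrite eq_le lebesgue_outer_ge0 andbT.
apply: ereal_inf_lbound; exists (fun=> (0, 0)%R); first by move=> x.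
by apply: eseries0 => k _ _; rewrite /box_volume big_ord_recl mxE subr0 maxxx mul0r.
Qed.

Lemma lebesgue_outer_sigma_subadditive : sigma_subadditive lebesgue_outer.
Proof.
move=> A; have [[i ioo]|] := pselect (exists i, lebesgue_outer (A i) = +oo).
  rewrite (eseries_pinfty _ _ ioo) ?leey// => n _.
  by rewrite -ltNye (lt_le_trans _ (lebesgue_outer_ge0 _)).
rewrite -forallNE => Aoo.
apply/lee_addgt0Pr => e e0.
rewrite (le_trans _ (epsilon_trick _ _ (ltW e0)))//; last first.
  by move=> n; exact: lebesgue_outer_ge0.
pose P n (B : nat -> 'rV[R]_m.+1 * 'rV[R]_m.+1) :=
  A n `<=` \bigcup_k box (B k) /\
  \sum_(k <oo) box_volume (B k) <= lebesgue_outer (A n) + (e / (2 ^ n.+1)%:R)%:E.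
have [G PG] : {G & forall n, P n (G n)}.
  apply: (@choice _ _ P) => n.
  have en1 : (0 < e / (2 ^ n.+1)%:R)%R by rewrite divr_gt0// ltr0n expn_gt0.
  have fA : lebesgue_outer (A n) \is a fin_num.
    rewrite ge0_fin_numE ?lebesgue_outer_ge0// ltey; exact/eqP/Aoo.
  have [x [B AB <-] xS] := lb_ereal_inf_adherent en1 fA.
  by exists B; split => //; exact/ltW.
pose v (ij : nat * nat) := box_volume (G ij.1 ij.2).
have v0 i j : 0 <= box_volume (G i j) by exact: box_volume_ge0.
apply: (@le_trans _ _ (\esum_(ij in [set: nat * nat]) v ij)).
  have /card_esym/ppcard_eqP[f] := card_nat2.
  apply: ereal_inf_lbound; exists (fun k => G (f k).1 (f k).2).
    move=> t [i _] /((PG i).1 _)[j _ Gt].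
    by exists (f^-1%FUN (i, j)) => //=; rewrite invK ?inE.
  by rewrite [RHS](reindex_esum [set: nat] _ f)//
    -nneseries_esumT// => k; exact: v0.
have -> : \esum_(ij in [set: nat * nat]) v ij =
    \sum_(i <oo) \sum_(j <oo) box_volume (G i j).
  rewrite nneseries_esumT; last first.
    by move=> i; apply: nneseries_ge0 => j _ _; exact: v0.
  under [RHS]eq_esum do rewrite nneseries_esumT//.
  rewrite (esum_esum (a := fun i j => box_volume (G i j)))//.
  by congr esum; apply/seteqP; split.
apply: lee_nneseries => [i _ _|i _]; last exact: (PG i).2.
by apply: nneseries_ge0 => j _ _; exact: v0.
Qed.

HB.instance Definition _ := isOuterMeasure.Build R 'rV[R]_m.+1 lebesgue_outer
  lebesgue_outer0 lebesgue_outer_ge0 le_lebesgue_outer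
  lebesgue_outer_sigma_subadditive.

(* The carrier caratheodory_type lebesgue_outer is 'rV[R]_m.+1 with the
   sigma-algebra of Lebesgue-measurable (not only Borel) sets. *)
Definition lebesgue_rV : set (caratheodory_type lebesgue_outer) -> \bar R :=
  lebesgue_outer.

HB.instance Definition _ := isMeasure.Build _ _ _ lebesgue_rV
  (@caratheodory_measure0 _ _ lebesgue_outer)
  (@caratheodory_measure_ge0 _ _ lebesgue_outer)
  (@caratheodory_measure_sigma_additive _ _ lebesgue_outer).

End lebesgue_measure_rV.

Section bernstein.
Context (R : realType) (m : nat).
Local Notation rV := 'rV[R]_m.+1.
Local Notation mu := (@lebesgue_rV R m).
Implicit Types (A B : set rV) (Psi : set rV -> R -> set rV) (n : nat).

Definition jordan_measurable A :=
  bounded_set A /\ mu (closure A `\` A°) = 0%E.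

(* Regular compact means bounded and equal to the closure of its interior. *)
Definition regular_jordan A := jordan_measurable A /\ regclosed A.

Definition dmu A B : \bar R := mu (A `+` B).

(* Only the values of Psi on Jordan measurable sets and on [0, 1] matter. *)
Definition subset_generating Psi :=
  [/\ forall A (t : R), jordan_measurable A -> 0 <= t <= 1 ->
        regular_jordan (Psi A t),
      forall A (t : R), jordan_measurable A -> 0 <= t <= 1 ->
        mu (Psi A t `\` A) = 0%E,
      forall A (t : R), jordan_measurable A -> 0 <= t <= 1 ->
        mu (Psi A t) = (t%:E * mu A)%E &
      forall A (s t : R), jordan_measurable A -> 0 <= s <= 1 -> 0 <= t <= 1 ->
        s <= t -> Psi A s `<=` Psi A t].

Definition partition_cell n (A : 'I_n.+1 -> set rV) (chi : {set 'I_n.+1}) :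
    set rV :=
  if chi == finset.set0 then set0
  else (\bigcap_(k in [set` chi]) A k) `\` (\bigcup_(l in [set` ~: chi]) A l).

Definition partition_average Psi n (alpha : 'I_n.+1 -> R)
    (A : 'I_n.+1 -> set rV) : set rV :=
  \bigcup_(chi in [set: {set 'I_n.+1}])
    Psi (partition_cell A chi) (\sum_(k in chi) alpha k).

Definition dmu_continuous01 (F : R -> set rV) :=
  forall x : R, 0 <= x <= 1 -> forall e : R, 0 < e ->
  exists2 d : R, 0 < d & forall y : R, 0 <= y <= 1 -> `|x - y| < d ->
    (dmu (F x) (F y) < e%:E)%E.

Definition set_bernstein Psi n (F : R -> set rV) (x : R) : set rV :=
  partition_average Psi
    (fun i : 'I_n.+1 => 'C(n, i)%:R * x ^+ i * (1 - x) ^+ (n - i))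
    (fun i : 'I_n.+1 => F (i%:R / n%:R)).

End bernstein.

(* Main.v *)
Require Import Defs.
From mathcomp Require Import all_boot all_order all_algebra.
From mathcomp Require Import all_classical all_reals all_analysis.
From mathcomp Require Import ring lra.
Import Order.TTheory GRing.Theory Num.Theory.
Import numFieldNormedType.Exports.
Local Open Scope classical_set_scope.
Local Open Scope ring_scope.

Set Implicit Arguments.
Unset Strict Implicit.
Unset Printing Implicit Defensive.

(** Let [C = F x] and [A_i = F (i/n)], and let [t] be the total weight of a cell
    [Om] of the partition.  If [a] and [b] are the volumes of [Om \ C] and
    [Om & C], then [Psi Om t] has volume [t (a + b)], and checking [t <= 1/2]
    and [t >= 1/2] separately shows that it differs from [C] inside [Om] by at
    most [4 (t a + (1 - t) b)].  Summed over all cells,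
    [t a + (1 - t) b] gives exactly the weighted sum of the [d (C, A_i)], so
    [d (C, average) <= 4 \sum_i alpha_i d (C, A_i)].  By compactness
    [d (F x, F y) <= e + K (x - y)^2] on the unit interval, and the variance
    [x (1 - x) / n] of the Bernstein weights concludes. *)

(** * Measurability of half-spaces, boxes, open and closed sets *)

Section lebesgue_sets.
Context (R : realType) (m : nat).
Local Notation rV := 'rV[R]_m.+1.
Local Notation mu := (@lebesgue_outer R m).
Local Notation meas := (caratheodory_measurable mu).
Implicit Types (A B C X : set rV).

(** Cutting along the hyperplane [x_i = c] changes only the factor of index [i]. The truncation at 0
    keeps this factor additive when [c] lies outside the side or the box is empty. *)
Lemma box_volume_split (B : rV * rV) (i : 'I_m.+1) (c : R) :
  (box_volume B =
   box_volume (B.1, \row_j if j == i then Num.min (B.2 ord0 j) c else B.2 ord0 j) +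
   box_volume (\row_j if j == i then Num.max (B.1 ord0 j) c else B.1 ord0 j, B.2))%E.
Proof.
rewrite /box_volume -EFinD; congr EFin.
rewrite [LHS](bigD1 i) //= [X in _ = X + _](bigD1 i) //=.
rewrite [X in _ = _ + X](bigD1 i) //= !mxE eqxx.
have side (G H : 'I_m.+1 -> R) : (forall j, j != i -> G j = H j) ->
    \prod_(j < m.+1 | j != i) G j = \prod_(j < m.+1 | j != i) H j.
  by move=> GH; apply: eq_bigr => j /GH.
rewrite (side (fun j => Num.max 0 ((\row_k if k == i then Num.min (B.2 ord0 k) c
    else B.2 ord0 k) ord0 j - B.1 ord0 j))
  (fun j => Num.max 0 (B.2 ord0 j - B.1 ord0 j))); last first.
  by move=> j /negPf ji; rewrite mxE ji.
rewrite (side (fun j => Num.max 0 (B.2 ord0 j - (\row_k if k == i then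
    Num.max (B.1 ord0 k) c else B.1 ord0 k) ord0 j))
  (fun j => Num.max 0 (B.2 ord0 j - B.1 ord0 j))); last first.
  by move=> j /negPf ji; rewrite mxE ji.
rewrite -mulrDl; congr (_ * _).
move: (B.1 ord0 i) (B.2 ord0 i) => a b.
have [bc|cb] := leP b c; have [ac|ca] := leP a c.
- by rewrite (max_l (_ : b - c <= 0)) ?addr0 // subr_le0.
- by rewrite !(max_l (_ : b - a <= 0)) ?addr0 // subr_le0 ltW ?(le_lt_trans bc).
- by rewrite !max_r ?subr_ge0 ?(ltW cb) // ?(le_trans ac (ltW cb)) //; ring.
- by rewrite (max_l (_ : c - a <= 0)) ?add0r // subr_le0 ltW.
Qed.

(** Each box of a covering of [X] is cut along the hyperplane: the lower pieces cover the part of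
    [X] in the half-space, the upper ones cover the rest, and the volumes add up. This is
    Caratheodory's criterion. *)
Lemma halfspace_measurable (i : 'I_m.+1) (c : R) :
  meas [set x : rV | x ord0 i <= c].
Proof.
apply: le_caratheodory_measurable => X.
apply: le_ereal_inf_tmp => _ [B XB <-].
pose B1 k := ((B k).1, \row_j if j == i then Num.min ((B k).2 ord0 j) c
  else (B k).2 ord0 j).
pose B2 k := (\row_j if j == i then Num.max ((B k).1 ord0 j) c
  else (B k).1 ord0 j, (B k).2).
rewrite (@eq_eseriesr _ _ (fun k => box_volume (B1 k) + box_volume (B2 k))%E); last first.
  by move=> k _; exact: box_volume_split.
rewrite nneseriesD; [|by move=> *; exact: box_volume_ge0..].
apply: leeD; apply: ereal_inf_lbound.
- exists B1 => // x [/XB[k _ Bx] /= xc]; exists k => // j.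
  rewrite /= mxE; have := Bx j; case: eqP => [->|//].
  by rewrite le_min xc andbT.
- exists B2 => // x [/XB[k _ Bx] /= /negP]; rewrite -ltNge => xc; exists k => // j.
  rewrite /= mxE; have := Bx j; case: eqP => [->|//].
  by rewrite gt_max xc andbT.
Qed.

Lemma measC A : meas A -> meas (~` A).
Proof. exact: caratheodory_measurable_setC. Qed.

Lemma measI A B : meas A -> meas B -> meas (A `&` B).
Proof. exact: caratheodory_measurable_setI. Qed.

Lemma measD A B : meas A -> meas B -> meas (A `\` B).
Proof. by move=> mA mB; apply: measI => //; apply: measC. Qed.

Lemma meas_fin_bigcap (I : finType) (A : I -> set rV) :
  (forall i, meas (A i)) -> meas [set x | forall i, A i x].
Proof.
move=> mA.
rewrite (_ : mkset _ = \bigcap_(i in [set: I]) A i); last first.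
  by apply/seteqP; split => x /= Ax i; [move=> _|]; exact: Ax.
apply: (@fin_bigcap_measurable _ (caratheodory_type mu)) => [|i _].
  exact: finite_finset.
exact: mA.
Qed.

Lemma box_measurable (B : rV * rV) : meas (box B).
Proof.
apply: meas_fin_bigcap => i.
rewrite (_ : (fun _ => _) = [set x : rV | x ord0 i <= B.2 ord0 i] `\`
   [set x : rV | x ord0 i <= B.1 ord0 i]).
  by apply: measD; exact: halfspace_measurable.
apply/seteqP; split => x /=.
  by move=> /andP[ax xb]; split=> //; apply/negP; rewrite -ltNge.
by move=> [-> /negP]; rewrite -ltNge andbT.
Qed.

(** An open set is the union of the countably many boxes with rational corners that it contains. *)
Lemma open_measurable_rV A : open A -> meas A.
Proof.
move=> oA.
pose b (q : 'rV[rat]_m.+1 * 'rV[rat]_m.+1) : rV * rV :=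
  (map_mx ratr q.1, map_mx ratr q.2).
pose G q := if pselect (box (b q) `<=` A) then box (b q) else set0.
have -> : A = \bigcup_q G q.
  apply/seteqP; split=> x; last first.
    by move=> [q _]; rewrite /G; case: pselect => [bA /bA|_ []].
  move=> Ax; have : nbhs x A by exact: open_nbhs_nbhs.
  move=> /nbhs_ballP[e /= e0 eA].
  (* Corners within [e] of [x] in every coordinate keep the box inside the sup-norm ball; choosing
     them strictly below and strictly above puts [x] in the box. *)
  have lq i : {q : rat | ratr q \in `]x ord0 i - e, x ord0 i[}.
    by apply: cid; apply: rat_in_itvoo; rewrite ltrBlDr ltrDl.
  have uq i : {q : rat | ratr q \in `]x ord0 i, x ord0 i + e[}.
    by apply: cid; apply: rat_in_itvoo; rewrite ltrDl.
  pose q : 'rV[rat]_m.+1 * 'rV[rat]_m.+1 :=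
    (\row_i sval (lq i), \row_i sval (uq i)).
  have qA : box (b q) `<=` A.
    move=> y yq; apply: eA; split=> // j i; rewrite (ord1 j).
    have /andP[] := yq i; rewrite !mxE /=.
    case: (lq i) (uq i) => l /=; rewrite in_itv/= => /andP[l1 l2] [u] /=.
    rewrite in_itv/= => /andP[u1 u2] y1 y2.
    by rewrite /ball /= ltr_norml; apply/andP; split; lra.
  exists q => //; rewrite /G; case: pselect => // ? i.
  rewrite !mxE /=.
  case: (lq i) (uq i) => l /=; rewrite in_itv/= => /andP[l1 l2] [u] /=.
  by rewrite in_itv/= => /andP[u1 u2]; rewrite l2 ltW.
apply: (@countable_bigcupT_measurable _ (caratheodory_type mu)).
  exact: countableP.
move=> q; rewrite /G; case: pselect => ?; first exact: box_measurable.
exact: caratheodory_measurable_set0.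
Qed.

Lemma closed_measurable_rV A : closed A -> meas A.
Proof.
move=> cA; rewrite -(setCK A); apply/measC/open_measurable_rV.
exact: closed_openC.
Qed.

(** * Finite volumes and their additivity *)

Lemma lebesgue_outer_lt_pinfty A : bounded_set A -> (mu A < +oo)%E.
Proof.
move=> /ex_strict_bound_gt0[M M0 AM].
(* One cube covers [A]; all the other boxes are degenerate and have volume 0. *)
pose B k : rV * rV := if k is 0%N then (const_mx (- M), const_mx M) else (0, 0).
apply: (@le_lt_trans _ _ (\sum_(k <oo) box_volume (B k))%E).
  apply: ereal_inf_lbound; exists B => // x Ax; exists 0%N => //= i.
  rewrite !mxE -ltrNl; have := AM x Ax.
  move=> /= xM; have : `|x ord0 i| < M.
    by apply: le_lt_trans xM; rewrite [leRHS]mx_normrE;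
      exact: (le_bigmax _ (fun ij => `|x ij.1 ij.2|) (ord0, i)).
  by rewrite ltr_norml => /andP[xM1 xM2]; rewrite ltrNl xM1 ltW.
rewrite (@nneseries_split _ _ _ 1) ?addn0; last by move=> *; exact: box_volume_ge0.
rewrite big_nat1 eseries0 ?adde0; last first.
  move=> [//|k] _ _ /=; rewrite /box_volume /= big_ord_recl mxE subr0 maxxx.
  by rewrite mul0r.
by rewrite ltry.
Qed.

(** Real values allow linear arithmetic. Since [fine] sends infinity to 0, finiteness has to be
    tracked alongside. *)
Definition vol A : R := fine (mu A).
Local Notation fin A := (mu A < +oo)%E.

Lemma mu_vol A : fin A -> mu A = (vol A)%:E.
Proof. by move=> fA; rewrite fineK // ge0_fin_numE // lebesgue_outer_ge0. Qed.

Lemma vol_ge0 A : 0 <= vol A.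
Proof. exact/fine_ge0/lebesgue_outer_ge0. Qed.

Lemma fin_subset A B : A `<=` B -> fin B -> fin A.
Proof. by move=> AB; apply: le_lt_trans; exact: le_lebesgue_outer. Qed.

Lemma fin_setU A B : fin A -> fin B -> fin (A `|` B).
Proof.
move=> fA fB; apply: le_lt_trans (outer_measureU2 _ _ _) _.
exact: lte_add_pinfty.
Qed.

Lemma fin_setY A B : fin A -> fin B -> fin (A `+` B).
Proof.
move=> fA fB; apply: fin_subset (fin_setU fA fB) => x [] [] ? _; by [left|right].
Qed.

Lemma le_vol A B : fin B -> A `<=` B -> vol A <= vol B.
Proof.
move=> fB AB; rewrite -lee_fin -!mu_vol //; last exact: fin_subset fB.
exact: le_lebesgue_outer.
Qed.

Lemma vol_setU_le A B : fin A -> fin B -> vol (A `|` B) <= vol A + vol B.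
Proof.
move=> fA fB; rewrite -lee_fin EFinD -!mu_vol //; first exact: outer_measureU2.
exact: fin_setU.
Qed.

Lemma vol_split X B : meas B -> fin X -> vol X = vol (X `&` B) + vol (X `\` B).
Proof.
move=> mB fX; apply: EFin_inj; rewrite EFinD -!mu_vol //.
- by apply: fin_subset fX => x [].
- by apply: fin_subset fX => x [].
Qed.

Lemma vol_setY_triangle A B C : fin A -> fin B -> fin C ->
  vol (A `+` C) <= vol (A `+` B) + vol (B `+` C).
Proof.
move=> fA fB fC; apply: le_trans (vol_setU_le (fin_setY fA fB) (fin_setY fB fC)).
apply: le_vol; first by apply: fin_setU; exact: fin_setY.
move=> x; rewrite /setY /=; have [Bx|nBx] := pselect (B x); tauto.
Qed.

Lemma vol0 : vol set0 = 0.
Proof. by rewrite /vol lebesgue_outer0. Qed.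

(** Caratheodory splitting along one level set of [f] at a time, by induction on a duplicate-free
    list of labels. *)
Lemma vol_partition (T : finType) (f : rV -> T) X :
  (forall t, meas (f @^-1` [set t])) -> fin X ->
  vol X = \sum_t vol (X `&` f @^-1` [set t]).
Proof.
move=> mf fX.
suff H (s : seq T) : uniq s ->
    vol (X `&` [set x | f x \in s]) = \sum_(t <- s) vol (X `&` f @^-1` [set t]).
  rewrite -big_enum -H ?enum_uniq //; congr vol.
  by apply/seteqP; split => x //=; [rewrite mem_enum | case].
elim: s => [_|t s IH /= /andP[ts us]].
  by rewrite big_nil -[RHS]vol0; congr vol; apply/seteqP; split => x // [].
rewrite big_cons -IH // (vol_split (mf t)); last by apply: fin_subset fX => x [].
congr (_ + _); congr vol; apply/seteqP; split => x /=; rewrite inE.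
- by move=> [[Xx _] ->].
- by move=> [Xx ->]; rewrite eqxx.
- by move=> [[Xx /orP[/eqP|]]].
- move=> [Xx fs]; split; first by rewrite fs orbT.
  by move=> fxt; rewrite -fxt fs in ts.
Qed.

Lemma fin_fin_bigcup (T : finType) (A : T -> set rV) :
  (forall t, fin (A t)) -> fin (\bigcup_t A t).
Proof.
move=> fA; suff H (s : seq T) : fin [set x | exists2 t, t \in s & A t x].
  apply: fin_subset (H (enum T)) => x [t _ Atx]; exists t => //.
  by rewrite mem_enum.
elim: s => [|t s IH].
  by apply: (@fin_subset _ set0) => [x [] //|]; rewrite lebesgue_outer0 ltry.
apply: fin_subset (fin_setU (fA t) IH) => x [u].
by rewrite inE => /orP[/eqP -> | us] Ax; [left|right; exists u].
Qed.

Lemma vol_bigcup_le (T : finType) (A : T -> set rV) X :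
  (forall t, fin (A t)) -> X `<=` \bigcup_t A t -> vol X <= \sum_t vol (A t).
Proof.
move=> fA XA; suff H (s : seq T) :
    fin [set x | exists2 t, t \in s & A t x] /\
    vol [set x | exists2 t, t \in s & A t x] <= \sum_(t <- s) vol (A t).
  rewrite -big_enum; have [fs] := H (enum T); apply: le_trans; apply: le_vol => //.
  by move=> x /XA [t _ Atx]; exists t => //; rewrite mem_enum.
elim: s => [|t s [fs IH]].
  rewrite big_nil (_ : mkset _ = set0) ?vol0 ?lebesgue_outer0 ?ltry //.
  by apply/seteqP; split => x // [].
rewrite (_ : mkset _ = A t `|` [set x | exists2 u, u \in s & A u x]).
  split; first exact: fin_setU.
  by rewrite big_cons (le_trans (vol_setU_le _ _)) // lerD2l.
apply/seteqP; split => x.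
  by move=> [u]; rewrite inE => /orP[/eqP -> | us] Ax; [left|right; exists u].
by move=> [Ax|[u us Ax]]; [exists t|exists u] => //; rewrite inE ?eqxx ?us ?orbT.
Qed.

(** * Jordan measurable sets and the cells they generate *)

Lemma regular_jordan_measurable A : regular_jordan A -> meas A.
Proof.
by move=> [_ <-]; apply: closed_measurable_rV; exact: closed_closure.
Qed.

Lemma jordan_fin A : jordan_measurable A -> fin A.
Proof. by move=> [bA _]; exact: lebesgue_outer_lt_pinfty. Qed.

Lemma regular_jordan_fin A : regular_jordan A -> fin A.
Proof. by move=> [/jordan_fin]. Qed.

Lemma jordan_set0 : jordan_measurable (set0 : set rV).
Proof.
split; first by exists 0; split => // M _ x [].
by rewrite closure0 set0D; exact: lebesgue_outer0.
Qed.

(* Away from all the boundaries of the [A k], membership in each [A k], hence in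
   the cell, is locally constant. *)
Lemma partition_cell_jordan n (A : 'I_n.+1 -> set rV) (chi : {set 'I_n.+1}) :
  (forall k, jordan_measurable (A k)) ->
  jordan_measurable (partition_cell A chi).
Proof.
move=> jA; rewrite /partition_cell.
case: (set_0Vmem chi) => [->|[k kchi]]; first by rewrite eqxx; exact: jordan_set0.
case: eqP => [e|_]; first by rewrite e inE in kchi.
split.
  have [[M [Mr HM]] _] := jA k; exists M; split => // M' MM' x [xA _].
  by apply: (HM M' MM'); exact: xA.
set S := (X in closure X).
have fb k' : mu (closure (A k') `\` (A k')°) = 0%E by exact: (jA k').2.
apply/eqP; rewrite eq_le lebesgue_outer_ge0 andbT.
(* The union of the boundaries is null, so it remains to show that it contains the boundary of the
   cell. *)
have -> : (0 = mu (\bigcup_k' (closure (A k') `\` (A k')°)))%E.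
  rewrite mu_vol; last by apply: fin_fin_bigcup => j; rewrite fb ltry.
  apply/eqP; rewrite eqe eq_le vol_ge0 /=.
  rewrite (le_trans (vol_bigcup_le (A := fun j => closure (A j) `\` (A j)°) _ _)) //.
    by move=> j; rewrite fb ltry.
  by rewrite big1 // => j _; rewrite /vol fb.
apply: le_lebesgue_outer => y [Sy nSy]; apply: contrapT => ny.
(* A point on no boundary is either interior to [A k'] or interior to the complement. *)
have loc k' : \forall z \near y, A k' z <-> A k' y.
  have [iy|niy] := pselect ((A k')° y).
    by near=> z; split=> _; [exact: interior_subset|near: z; exact: iy].
  have ncy : ~ closure (A k') y by move=> cy; apply: ny; exists k'.
  have cny : (~` closure (A k'))° y.
    by apply: open_nbhs_nbhs; split => //; exact/closed_openC/closed_closure.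
  have nAy : ~ A k' y by move=> Ay; apply: ncy; exact: subset_closure.
  near=> z; split=> // Az.
  have : (~` closure (A k')) z by near: z; exact: cny.
  by move/(_ (subset_closure Az)).
have locS : \forall z \near y, S z <-> S y.
  near=> z.
  have e k' : A k' z <-> A k' y by move: k'; near: z; exact: filter_forall.
  split => -[zA zN]; split.
  - by move=> j jc; apply: (e j).1; exact: zA.
  - by move=> [j jc Aj]; apply: zN; exists j => //; apply: (e j).2.
  - by move=> j jc; apply: (e j).2; exact: zA.
  - by move=> [j jc Aj]; apply: zN; exists j => //; apply: (e j).1.
(* As [y] is in the closure of [S], some nearby [z] is in [S]; local constancy then makes [y] an
   interior point, a contradiction. *)
have [z [Sz ez]] := Sy _ locS.
apply: nSy; have Syy : S y by apply/ez.
by apply: filterS locS => w /= [_]; apply.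
Unshelve. all: by end_near. Qed.

End lebesgue_sets.

Lemma sum_weights_itv (R : realType) (T : finType) (alpha : T -> R)
    (chi : {set T}) : (forall i, 0 <= alpha i) -> \sum_i alpha i = 1 ->
  0 <= \sum_(i in chi) alpha i <= 1.
Proof.
move=> alpha0 <-; rewrite sumr_ge0 //= [leRHS](bigID (mem chi)) /= lerDl.
exact: sumr_ge0.
Qed.

(** * Distance from a set to a partition average *)

Section partition_average_distance.
Context (R : realType) (m : nat).
Local Notation rV := 'rV[R]_m.+1.
Local Notation mu := (@lebesgue_outer R m).
Local Notation meas := (caratheodory_measurable mu).
Local Notation fin A := (mu A < +oo)%E.
Context (Psi : set rV -> R -> set rV) (sgPsi : subset_generating Psi).

Lemma subset_generating_dist (Om C : set rV) (t : R) :
  jordan_measurable Om -> meas Om -> meas C -> fin C -> 0 <= t <= 1 ->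
  vol (Psi Om t `\` C) + vol ((Om `&` C) `\` Psi Om t) <=
  (t * vol (Om `\` C) + (1 - t) * vol (Om `&` C)) *+ 4.
Proof.
case: sgPsi => rPsi sPsi vPsi _ jOm mOm mC fC t01.
have fOm := jordan_fin jOm.
have rP := rPsi _ _ jOm t01; have fP := regular_jordan_fin rP.
have mP := regular_jordan_measurable rP.
have sP : vol (Psi Om t `\` Om) = 0 by exact: (congr1 fine (sPsi _ _ jOm t01)).
have vP : vol (Psi Om t) = t * vol Om.
  have := congr1 fine (vPsi _ _ jOm t01).
  by rewrite -[lebesgue_rV Om]/(mu Om) (mu_vol fOm).
have fD (X Y : set rV) : fin X -> fin (X `\` Y) by apply: fin_subset => x [].
have fI (X Y : set rV) : fin X -> fin (X `&` Y) by apply: fin_subset => x [].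
have e1 := vol_split mC fP; have e2 := vol_split mC fOm.
have e3 := vol_split mP (fI Om C fOm).
(* [Psi Om t] leaves [Om] only on a null set; this gives both this bound and the next one. *)
have le1 : vol (Psi Om t `\` C) <= vol (Om `\` C).
  rewrite -[leRHS]addr0 -sP.
  apply: le_trans (vol_setU_le (fD _ _ fOm) (fD _ _ fP)).
  apply: le_vol; first by apply: fin_setU; exact: fD.
  by move=> x [Px nCx]; have [Ox|nOx] := pselect (Om x); [left|right].
have le2 : vol (Psi Om t `&` C) <= vol ((Om `&` C) `&` Psi Om t).
  rewrite -[leRHS]addr0 -sP.
  apply: le_trans (vol_setU_le (fI _ _ (fI _ _ fOm)) (fD _ _ fP)).
  apply: le_vol; first by apply: fin_setU; [exact/fI/fI|exact: fD].
  by move=> x [Px Cx]; have [Ox|nOx] := pselect (Om x); [left|right].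
have p0 := vol_ge0 (Psi Om t `\` C).
have a0 := vol_ge0 (Om `\` C); have b0 := vol_ge0 (Om `&` C).
have q0 := vol_ge0 (Psi Om t `&` C).
case/andP: t01 => t0 t1.
move: e1 e2 e3 le1 le2 p0 a0 b0 q0; rewrite {}vP.
move: (vol Om) (vol (Om `\` C)) (vol (Om `&` C)) (vol (Psi Om t `\` C)) => w a b p.
move: (vol (Psi Om t `&` C)) (vol (Om `&` C `&` Psi Om t)) => q s.
move: (vol (Om `&` C `\` Psi Om t)) => d e1 e2 e3 le1 le2 p0 a0 b0 q0.
(* Here [p + q = t (a + b)] and [d = b - s <= b - q], so [p + d <= 2 p + (1 - t) b - t a]; only [p]
   remains to be bounded. *)
have ta0 : 0 <= t * a by apply: mulr_ge0.
have tb0 : 0 <= t * b by apply: mulr_ge0.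
have tb1 : t * b <= b by rewrite ler_piMl.
have ta1 : t * a <= a by rewrite ler_piMl.
rewrite e2 mulrDr in e1; rewrite mulrBl mul1r -mulr_natl.
(* For [t <= 1/2], use [p <= t (a + b)] and [t b <= (1 - t) b]; for larger [t], use
   [p <= a <= 2 t a]. *)
have [t2|t2] := leP t (1 / 2).
  have : t * b <= 1 / 2 * b by rewrite ler_wpM2r.
  by move=> ?; lra.
have : 1 / 2 * a <= t * a by rewrite ler_wpM2r // ltW.
by move=> ?; lra.
Qed.

Context (n : nat) (A : 'I_n.+1 -> set rV) (alpha : 'I_n.+1 -> R).

Let label (y : rV) : {set 'I_n.+1} := [set k | `[< A k y >]]%SET.

(** As level sets of [label], the cells partition the whole space. For empty [chi] this is the
    complement of all the [A k], whereas [partition_cell] is empty there. *)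
Let cell (chi : {set 'I_n.+1}) : set rV := label @^-1` [set chi].

Lemma in_label k y : (k \in label y) <-> A k y.
Proof. by rewrite inE; split => /asboolP. Qed.

Lemma partition_cellE chi : chi != finset.set0 -> partition_cell A chi = cell chi.
Proof.
rewrite /partition_cell => /negPf ->; apply/seteqP; split => y /=.
  move=> [yA nyA]; apply/setP => k; apply/idP/idP.
    move=> /in_label Aky; apply: contrapT => /negP kchi; apply: nyA.
    by exists k => //=; rewrite inE.
  by move=> kchi; apply/in_label; exact: yA.
rewrite /cell /= => <-; split => [k /in_label //|[k /=]].
by rewrite inE => /negP nk /in_label.
Qed.

Lemma partition_average_dist (C : set rV) :
  (forall i, regular_jordan (A i)) -> meas C -> fin C ->
  (forall i, 0 <= alpha i) -> \sum_i alpha i = 1 ->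
  vol (C `+` partition_average Psi alpha A) <=
  (\sum_i alpha i * vol (C `+` A i)) *+ 4.
Proof.
move=> rA mC fC alpha0 alpha1.
have mA i := regular_jordan_measurable (rA i).
have fA i := regular_jordan_fin (rA i).
have mcell chi : meas (cell chi).
  rewrite (_ : cell chi =
      [set y | forall k, (if k \in chi then A k else ~` A k) y]).
    by apply: meas_fin_bigcap => k; case: ifP => _ //; exact: measC.
  apply/seteqP; split => y /=.
    by rewrite /cell /= => <- k; case: ifPn => [/in_label //|/negP nk /= Ak];
      apply/nk/in_label.
  move=> yA; apply/setP => k; have := yA k; case: ifP => _ /in_label //.
  by move/negP/negPf.
have fD (X Y : set rV) : fin X -> fin (X `\` Y) by apply: fin_subset => x [].
have fI (X Y : set rV) : fin X -> fin (Y `&` X) by apply: fin_subset => x [].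
pose t (chi : {set 'I_n.+1}) := \sum_(k in chi) alpha k.
have tC (chi : {set 'I_n.+1}) : \sum_(k | k \notin chi) alpha k = 1 - t chi.
  by rewrite -alpha1 [X in _ = X - _](bigID (mem chi)) /= addrAC subrr add0r.
have t01 chi : 0 <= t chi <= 1.
  exact: sum_weights_itv.
(* On the cell of [chi], the set [C] differs from [A i] by [cell chi] minus [C] if [i] is in [chi],
   and by [cell chi] meet [C] otherwise. Exchanging the sums collects the weights [t chi] and
   [1 - t chi]. *)
have -> : \sum_i alpha i * vol (C `+` A i) =
    \sum_chi (t chi * vol (cell chi `\` C) + (1 - t chi) * vol (cell chi `&` C)).
  under eq_bigr => i _.
    rewrite (vol_partition mcell (fin_setY fC (fA i))) mulr_sumr.
    over.
  rewrite exchange_big /=; apply: eq_bigr => chi _.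
  rewrite (bigID (mem chi)) /= -tC /t !mulr_suml; congr (_ + _).
    apply: eq_bigr => i ichi; congr (_ * vol _); apply/seteqP; split => y.
      move=> [+ ey]; have : A i y by apply/in_label; rewrite ey.
      by rewrite /setY /=; tauto.
    move=> [ey nCy]; split=> //; right; split=> //.
    by apply/in_label; rewrite ey.
  apply: eq_bigr => i ichi; congr (_ * vol _); apply/seteqP; split => y.
    move=> [+ ey]; have : ~ A i y by move/in_label; rewrite ey (negPf ichi).
    by rewrite /setY /=; tauto.
  move=> [ey Cy]; split=> //; left; split=> //.
  by move/in_label; rewrite ey (negPf ichi).
rewrite -sumrMnl.
pose P chi := Psi (partition_cell A chi) (t chi).
have jcell chi : jordan_measurable (partition_cell A chi).
  by apply: partition_cell_jordan => k; case: (rA k).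
have fP chi : fin (P chi).
  case: sgPsi => rPsi _ _ _.
  exact: regular_jordan_fin (rPsi _ _ (jcell chi) (t01 chi)).
(* The error charged to [chi]: what [P chi] adds outside [C], and the points of [C] in the cell that
   it misses. A point of [C] missed by the average is charged to its own label. *)
pose E chi := (P chi `\` C) `|` ((cell chi `&` C) `\` P chi).
have fE chi : fin (E chi) by apply: fin_setU; apply: fD => //; exact: fI.
apply: (le_trans (vol_bigcup_le fE _)).
  move=> y [[Cy nPy]|[[chi _ Py] nCy]].
    exists (label y) => //; right; split=> // Py; apply: nPy.
    by exists (label y).
  by exists chi => //; left.
apply: ler_sum => chi _.
apply: (le_trans (vol_setU_le _ _)); [exact: fD|exact/fD/fI|].
(* For empty [chi] the two kinds of cell differ, but [t chi = 0] makes [P chi] null, and only the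
   part of [C] outside all the [A k] is left. *)
have [chi0|chi0] := eqVneq chi finset.set0; last first.
  rewrite /P partition_cellE //.
  have := jcell chi; rewrite partition_cellE // => jc.
  exact: subset_generating_dist.
have t0 : t chi = 0 by rewrite /t chi0 big_set0.
have -> : vol (P chi `\` C) = 0.
  apply/eqP; rewrite eq_le vol_ge0 andbT.
  apply: (@le_trans _ _ (vol (P chi))); first by apply: le_vol => // x [].
  case: sgPsi => _ _ vPsi _.
  have := congr1 fine (vPsi _ _ (jcell chi) (t01 chi)).
  by rewrite [in fine (_ * _)]t0 mul0e => vP0; rewrite [leLHS]vP0.
rewrite t0 mul0r !add0r subr0 mul1r.
apply: (@le_trans _ _ (vol (cell chi `&` C))).
  by apply: le_vol => [|x []] //; exact: fI.
by rewrite mulrS lerDl mulrn_wge0 // vol_ge0.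
Qed.

End partition_average_distance.

(** * Moments of the Bernstein weights *)

Section bernstein_weights.
Context (R : realType).
Implicit Types (g : nat -> R) (x c : R) (n : nat).

(** The Bernstein polynomial with coefficients [g i]. Taking a sequence instead of a function on the
    unit interval makes the shift in the recursion below expressible. *)
Definition bernstein_op n g x : R :=
  \sum_(i < n.+1) 'C(n, i)%:R * x ^+ i * (1 - x) ^+ (n - i) * g i.

(** Pascal's rule, or conditioning on one Bernoulli trial. *)
Lemma bernstein_opS n g x :
  bernstein_op n.+1 g x =
  (1 - x) * bernstein_op n g x + x * bernstein_op n (fun i => g i.+1) x.
Proof.
rewrite /bernstein_op big_ord_recl /= [X in _ = _ * X + _]big_ord_recl /=.
rewrite mulrDr -addrA; congr (_ + _).
  by rewrite !bin0 !subn0 exprS; ring.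
(* A vanishing last term, with coefficient ['C(n, n.+1)], gives the three sums the same range. *)
rewrite !mulr_sumr [X in _ = X + _](_ : _ = \sum_(i < n.+1)
    'C(n, i.+1)%:R * x ^+ i.+1 * (1 - x) ^+ (n - i) * g i.+1); last first.
  rewrite [RHS]big_ord_recr /= bin_small // !mul0r addr0.
  apply: eq_bigr => i _; rewrite /bump /= add1n.
  by rewrite -(subnSK (ltn_ord i)) !exprS; ring.
rewrite -big_split /=; apply: eq_bigr => i _.
by rewrite /bump /= add1n binS natrD subSS exprS; ring.
Qed.

Lemma bernstein_op_cst n x : bernstein_op n (fun=> 1) x = 1.
Proof.
elim: n => [|n IH]; last by rewrite bernstein_opS IH; ring.
by rewrite /bernstein_op big_ord1 bin0 !expr0 !mulr1.
Qed.

(** Binomial variance plus squared bias. The centre [c] is arbitrary because the recursion replaces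
    it by [c - 1]. *)
Lemma bernstein_op_second_moment n x c :
  bernstein_op n (fun i => (i%:R - c) ^+ 2) x =
  n%:R * x * (1 - x) + (n%:R * x - c) ^+ 2.
Proof.
elim: n c => [|n IH] c.
  by rewrite /bernstein_op big_ord1 /= bin0 !expr0; ring.
rewrite bernstein_opS IH.
have -> : bernstein_op n (fun i => (i.+1%:R - c) ^+ 2) x =
    bernstein_op n (fun i => (i%:R - (c - 1)) ^+ 2) x.
  by apply: eq_bigr => i _; rewrite -natr1; ring.
by rewrite IH -[in RHS]natr1; ring.
Qed.

Lemma bernstein_op_variance n x : (0 < n)%N ->
  bernstein_op n (fun i => (x - i%:R / n%:R) ^+ 2) x = x * (1 - x) / n%:R.
Proof.
move=> n0; have n0' : n%:R != 0 :> R by rewrite pnatr_eq0 -lt0n.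
have -> : bernstein_op n (fun i => (x - i%:R / n%:R) ^+ 2) x =
    bernstein_op n (fun i => (i%:R - n%:R * x) ^+ 2) x / n%:R ^+ 2.
  rewrite /bernstein_op mulr_suml; apply: eq_bigr => i _.
  by field.
by rewrite bernstein_op_second_moment; field.
Qed.

Lemma bernstein_weight_ge0 n (i : nat) x : 0 <= x <= 1 ->
  0 <= 'C(n, i)%:R * x ^+ i * (1 - x) ^+ (n - i).
Proof.
by move=> /andP[x0 x1]; rewrite !mulr_ge0 ?exprn_ge0 ?subr_ge0.
Qed.

End bernstein_weights.

(** * A quadratic modulus of continuity from compactness *)

Section quadratic_modulus.
Context (R : realType) (d : R -> R -> R).
Context (d_sym : forall x y, d x y = d y x).
Context (d_triangle : forall x y z, 0 <= x <= 1 -> 0 <= y <= 1 ->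
  0 <= z <= 1 -> d x z <= d x y + d y z).
Context (d_cont : forall x, 0 <= x <= 1 -> forall e, 0 < e ->
  exists2 delta, 0 < delta &
    forall y, 0 <= y <= 1 -> `|x - y| < delta -> d x y < e).

Let near_covering01 : near_covering_within `[0 : R, 1].
Proof.
by apply/near_covering_withinP/compact_near_coveringP; exact: segment_compact.
Qed.

(** Compactness bounds the distance to 0, and the triangle inequality through 0 bounds all the
    others. *)
Lemma pseudometric_bounded01 :
  exists M, forall x y, 0 <= x <= 1 -> 0 <= y <= 1 -> d x y <= M.
Proof.
have H0 : 0 <= (0 : R) <= 1 by rewrite lexx ler01.
have : \forall M \near +oo, `[0, 1] `<=` [set x | d 0 x <= M].
  apply: near_covering01 => x; rewrite /= in_itv /= => x01.
  have [delta delta0 xdelta] := d_cont x01 ltr01.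
  near=> y M => /=; rewrite in_itv /= => y01.
  apply: (le_trans (d_triangle H0 x01 y01)).
  apply: (@le_trans _ _ (d 0 x + 1)).
    by rewrite lerD2l; apply/ltW/xdelta.
  by near: M; exact: nbhs_pinfty_ge (num_real _).
move=> /filter_ex[M HM].
exists (M + M) => x y x01 y01; apply: (le_trans (d_triangle x01 H0 y01)).
by rewrite d_sym lerD //; apply: HM; rewrite /= in_itv.
Unshelve. all: by end_near. Qed.

(** Near pairs are handled by continuity and [e]. For pairs at least [delta / 2] apart, a large [K]
    makes the quadratic term exceed the global bound [M]. Compactness yields one [K] for all
    points. *)
Lemma quadratic_modulus01 e : 0 < e ->
  exists2 K, 0 <= K & forall x y, 0 <= x <= 1 -> 0 <= y <= 1 ->
    d x y <= e + K * (x - y) ^+ 2.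
Proof.
move=> e0; have [M HM] := pseudometric_bounded01.
have : \forall K \near +oo, `[0, 1] `<=`
    [set x | forall y, 0 <= y <= 1 -> d x y <= e + K * (x - y) ^+ 2].
  apply: near_covering01 => x; rewrite /= in_itv /= => x01.
  have e2 : 0 < e / 2 by rewrite divr_gt0.
  have [delta delta0 xdelta] := d_cont x01 e2.
  have delta2 : 0 < delta / 2 by rewrite divr_gt0.
  near=> x' K => /=; rewrite in_itv /= => x'01 y y01.
  have K0 : 0 <= K by near: K; exact: nbhs_pinfty_ge (num_real _).
  have xx' : `|x - x'| < delta / 2.
    by near: x'; apply/nbhs_ballP; exists (delta / 2).
  (* In the near case both [x'] and [y] are within [delta] of [x], so each costs at most [e / 2]. *)
  have [x'y|x'y] := ltP `|x' - y| (delta / 2).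
    apply: (@le_trans _ _ e); last by rewrite lerDl mulr_ge0 // sqr_ge0.
    apply: (le_trans (d_triangle x'01 x01 y01)).
    rewrite [leRHS](splitr e) lerD // ltW //.
      by rewrite d_sym; apply: xdelta => //; lra.
    apply: xdelta => //; rewrite (_ : x - y = (x - x') + (x' - y)); last by ring.
    by apply: (le_lt_trans (ler_normD _ _)); lra.
  apply: (le_trans (HM _ _ x'01 y01)).
  apply: (@le_trans _ _ (K * (delta / 2) ^+ 2)).
    by rewrite -ler_pdivrMr ?exprn_gt0.
  rewrite ler_wpDl ?(ltW e0) // ler_wpM2l // -[leRHS]real_normK ?num_real //.
  by rewrite ler_pXn2r // nnegrE // ltW.
move=> /(filterI (nbhs_pinfty_ge (num_real 0))) /filter_ex[K [K0 HK]].
by exists K => // x y x01; apply: HK; rewrite /= in_itv.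
Unshelve. all: by end_near. Qed.

End quadratic_modulus.

(** * Uniform approximation by the set-valued Bernstein operator *)

Theorem theorem4p2 (R : realType) (m : nat)
    (Psi : set 'rV[R]_m.+1 -> R -> set 'rV[R]_m.+1)
    (F : R -> set 'rV[R]_m.+1) :
  subset_generating Psi ->
  (forall x : R, 0 <= x <= 1 -> regular_jordan (F x)) ->
  dmu_continuous01 F ->
  forall eps : R, 0 < eps ->
  exists2 N : nat, (0 < N)%N &
    forall (n : nat) (x : R), (N <= n)%N -> 0 <= x <= 1 ->
      (dmu (F x) (set_bernstein Psi n F x) < eps%:E)%E.
Proof.
move=> sgPsi rF cF eps eps0.
have fF x : 0 <= x <= 1 -> (lebesgue_outer (F x) < +oo)%E.
  by move=> /rF; exact: regular_jordan_fin.
pose d x y := vol (F x `+` F y).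
have d_sym x y : d x y = d y x by rewrite /d setYC.
have d_triangle x y z : 0 <= x <= 1 -> 0 <= y <= 1 -> 0 <= z <= 1 ->
    d x z <= d x y + d y z.
  by move=> /fF fx /fF fy /fF fz; exact: vol_setY_triangle.
have d_cont x : 0 <= x <= 1 -> forall e, 0 < e -> exists2 delta, 0 < delta &
    forall y, 0 <= y <= 1 -> `|x - y| < delta -> d x y < e.
  move=> x01 e e0; have [delta delta0 H] := cF x x01 e e0.
  exists delta => // y y01 xy; rewrite /d -lte_fin -mu_vol; first exact: H.
  by apply: fin_setY; exact: fF.
(* The factor 4 multiplies two errors, so each may be [eps / 8]. *)
have eps8 : 0 < eps / 8 by rewrite divr_gt0.
have [K K0 HK] := quadratic_modulus01 d_sym d_triangle d_cont eps8.
(* This makes [K / n < eps / 8] for [n > N], which controls the variance term uniformly in [x]. *)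
have [N HN] : exists N : nat, 8 * K / eps < N.+1%:R.
  exists (Num.truncn (8 * K / eps)); exact: Num.Theory.truncnS_gt.
exists N.+1 => // n x Nn x01.
have n0 : (0 < n)%N by apply: leq_trans Nn.
have n0' : 0 < n%:R :> R by rewrite ltr0n.
have in01 (i : 'I_n.+1) : 0 <= (i%:R / n%:R : R) <= 1.
  by rewrite divr_ge0 //= ler_pdivrMr // mul1r ler_nat -ltnS.
pose alpha (i : 'I_n.+1) : R := 'C(n, i)%:R * x ^+ i * (1 - x) ^+ (n - i).
have alpha1 : \sum_i alpha i = 1.
  by rewrite -[RHS](bernstein_op_cst n x); apply: eq_bigr => i _; rewrite mulr1.
have alpha0 i : 0 <= alpha i by exact: bernstein_weight_ge0.
have [rFx rFi] := (rF x x01, fun i => rF _ (in01 i)).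
have fB : (lebesgue_outer (set_bernstein Psi n F x) < +oo)%E.
  apply: fin_fin_bigcup => chi; case: sgPsi => rPsi _ _ _.
  apply: regular_jordan_fin; apply: rPsi.
    by apply: partition_cell_jordan => k; case: (rFi k).
  exact: (sum_weights_itv chi alpha0 alpha1).
rewrite -[dmu _ _]/(lebesgue_outer (F x `+` set_bernstein Psi n F x)).
rewrite mu_vol; last by apply: fin_setY => //; exact: fF.
rewrite lte_fin.
have Fx_meas := regular_jordan_measurable rFx.
apply: (le_lt_trans (partition_average_dist sgPsi rFi Fx_meas (fF _ x01)
  alpha0 alpha1)).
(* Averaging the quadratic modulus over the weights turns the squares into the variance; the
   constant survives because the weights sum to 1. *)
have : \sum_i alpha i * vol (F x `+` F (i%:R / n%:R)) <=
    eps / 8 + K * (x * (1 - x) / n%:R).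
  rewrite -(bernstein_op_variance x n0) mulr_sumr.
  have -> : eps / 8 = \sum_i alpha i * (eps / 8).
    by rewrite -mulr_suml alpha1 mul1r.
  rewrite -big_split /=; apply: ler_sum => i _; rewrite -/(alpha i) [K * _]mulrCA -mulrDr.
  by apply: ler_wpM2l => //; exact: HK.
have xx : x * (1 - x) <= 1.
  by case/andP: x01 => x0 x1; rewrite mulr_ile1 // ?subr_ge0 //; lra.
have Kn : K * (x * (1 - x) / n%:R) < eps / 8.
  rewrite mulrA ltr_pdivrMr //.
  apply: (@le_lt_trans _ _ K); first by rewrite ler_piMr.
  have : 8 * K / eps < n%:R by apply: lt_le_trans HN _; rewrite ler_nat.
  by rewrite ltr_pdivrMr // => ?; lra.
by rewrite -mulr_natl => ?; lra.
Qed.
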